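(* For every integer $n$ with $1\le n\le 40748$, the number $F(n)$ of faces in a random embedding of the complete graph $K_n$ satisfies $\mathbb{E}[F(n)]\le 5\ln(n)+5$.
   Context: A rotation system of a graph $G$ is a choice, for each vertex $v$, of a cyclic permutation $R_v$ (a single cycle) of the darts at $v$, where a dart is a pair $(v,e)$ with $e$ an edge incident with $v$. Let $R$ be the product of all $R_v$, and let $L$ be the fixed-point-free involution on the set of all darts that swaps the two darts $(u,e),(v,e)$ of each edge $e=uv$. Rotation systems correspond to (equivalence classes of) 2-cell embeddings of a connected graph $G$ in oriented closed surfaces; the faces of the embedding are the cycles of $R\circ L$ (the one-vertex graph without edges has one face). A random embedding of $G$ is one given by a rotation system chosen uniformly at random among all $\prod_{v}(\deg(v)-1)!$ rotation systems. *)

(* Defs.v *)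
From HB Require Import structures.
From mathcomp Require Import all_boot all_order all_algebra all_fingroup.
From mathcomp Require Import reals exp.

Set Implicit Arguments.
Unset Strict Implicit.
Unset Printing Implicit Defensive.

Import Order.TTheory GRing.Theory Num.Theory.

Record sgraph := SGraph {
  vertex :> finType;
  adj : rel vertex;
  adj_sym : symmetric adj;
  adj_irrefl : irreflexive adj }.

Lemma complete_sym n : symmetric (fun i j : 'I_n => i != j).
Proof. by move=> i j; rewrite eq_sym. Qed.

Lemma complete_irrefl n : irreflexive (fun i j : 'I_n => i != j).
Proof. by move=> i; rewrite eqxx. Qed.

Definition complete_graph (n : nat) : sgraph :=
  SGraph (@complete_sym n) (@complete_irrefl n).

Section RotationSystems.
Variable G : sgraph.

(* The dart (u, e) with e = uw is encoded as the ordered pair (u, w); this is *)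
(* one-to-one because G is simple.                                            *)
Definition dart : finType := {d : G * G | adj d.1 d.2}.

Definition darts_at (v : G) : {set dart} := [set d | (val d).1 == v].

Lemma dart_swap_subproof (d : dart) : adj (val d).2 (val d).1.
Proof. by rewrite adj_sym (valP d). Qed.

Definition dart_swap (d : dart) : dart :=
  exist _ ((val d).2, (val d).1) (dart_swap_subproof d).

Lemma dart_swapK : involutive dart_swap.
Proof. by case=> [[u w] uw]; apply: val_inj. Qed.

Definition dart_inv : {perm dart} := perm (inv_inj dart_swapK).

(* rho v is the cyclic permutation R_v of the darts at v, extended by the     *)
(* identity to all darts. If v is isolated, this forces rho v = 1.            *)
Definition is_rotation_system (rho : {ffun G -> {perm dart}}) : bool :=
  [forall v, perm_on (darts_at v) (rho v) &&
     [forall d in darts_at v, porbit (rho v) d == darts_at v]].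

Definition rotation_systems : {set {ffun G -> {perm dart}}} :=
  [set rho | is_rotation_system rho].

(* The factors have disjoint supports, so their order is irrelevant.          *)
Definition rotation_perm (rho : {ffun G -> {perm dart}}) : {perm dart} :=
  (\prod_(v : G) rho v)%g.

(* Permutations compose from left to right, so dart_inv * R is R o L. The     *)
(* one-vertex graph has no darts, but its embedding (in the sphere) has one   *)
(* face. Meaningful for connected G only.                                     *)
Definition num_faces (rho : {ffun G -> {perm dart}}) : nat :=
  if #|G| == 1%N then 1%N else #|porbits (dart_inv * rotation_perm rho)%g|.

Definition expected_faces (R : realType) : R :=
  ((\sum_(rho in rotation_systems) (num_faces rho)%:R)
     / #|rotation_systems|%:R)%R.

End RotationSystems.

(* Main.v *)
Require Import Defs.
From mathcomp Require Import all_boot all_order all_algebra.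
From mathcomp Require Import reals exp.
From mathcomp Require Import all_fingroup.
From mathcomp Require Import zify ring lra.

(* Choose the local rotations lazily, following the face that starts with a   *)
(* dart at the vertex k until it closes or leaves the vertices 0, ..., k. At  *)
(* each vertex the next dart is uniform among the admissible unused ones. If  *)
(* e = n - 1 - k vertices come after k, then each visited vertex keeps e      *)
(* unused darts leading beyond k but at most one leading to k, so that the    *)
(* walk returns to k with probability at most 1 / (e + 1), whatever its past; *)
(* and at a return after t visits it closes with probability at most 1 / (n - *)
(* 1 - t). Counting every face at its largest vertex, with weight one over    *)
(* its number of visits there, yields at most 2 / e faces on average for e >  *)
(* 0 and 2 H_(n-2) + 1 for e = 0, with H the harmonic numbers; the sum over k *)
(* is at most 4 ln n + 5.                                                     *)

Set Implicit Arguments.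
Unset Strict Implicit.
Unset Printing Implicit Defensive.

Import Order.TTheory GRing.Theory Num.Theory.

(** Probabilities are handled by counting: [following d r] collects the rotations whose face from
    [d] runs along [r]. Uniformity of the next dart enters as [following_le], an injection that
    trades one next dart for another by the 3-cycle of [porbit_switch]. It yields the two estimates
    of the walk: [following_close_le] for closing, [following_exit_le] for leaving beyond [k]. By
    induction over trails, [trail_bound] turns them into a bound on the mean weight of a dart
    through a potential [b], which [weight_bound_inner] and [weight_bound_last] choose. The weights
    add up to the number of faces ([sum_top_weight]), so [sum_weights] bounds the mean by 2 H_(n-2)
    + 1 + 2 H_(n-1), and [harmonic_le_ln] concludes. *)

(** * Exchanging two arcs of a cycle *)

Section Switch.
Local Open Scope group_scope.

Lemma porbit_stable (T : finType) (pT : predType T) (A : pT) (s : {perm T}) x y :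
  x \in A -> (forall z, z \in A -> s z \in A) -> y \in porbit s x -> y \in A.
Proof.
move=> Ax stA /porbitP[i ->]; elim: i => [|i IHi]; first by rewrite expg0 perm1.
by rewrite expgSr permM stA.
Qed.

Lemma porbit_apply (T : finType) (s : {perm T}) x : porbit s (s x) = porbit s x.
Proof. by have := porbit_perm s 1 x; rewrite expg1. Qed.

(* If the cycle of a reads a, y ... , x ... , z ... a with y = s a, then the   *)
(* product with the 3-cycle exchanges its arcs y ... and x ... .              *)
Lemma porbit_switch (T : finType) (s : {perm T}) a z x r :
    (s ^+ r) z = a -> (forall i, i <= r -> (s ^+ i) z != x) ->
    x \in porbit s a -> x != s a ->
  porbit (s * (tperm (s a) x * tperm (s a) z)) a = porbit s a.
Proof.
set y := s a; set t := tperm y x * tperm y z => za x_far xa x_neq_y.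
(* [i] is the distance from [z] to [x]; its minimality makes the points before [x] pairwise distinct
   ([subz]). *)
have [i xi i_min] : exists2 i, (s ^+ i) z = x
    & forall j, (s ^+ j) z = x -> i <= j.
  have ex_i : exists i, (s ^+ i) z == x.
    have /porbitP[i ->] := xa; exists (r + i)%N; rewrite expgD permM za //.
  case: (ex_minnP ex_i) => i /eqP xi i_min; exists i => // j /eqP.
  exact: i_min.
have yE : (s ^+ r.+1) z = y by rewrite expgSr permM za.
have lt_ri : r.+1 < i.
  rewrite ltnNge; apply/negP; rewrite leq_eqVlt => /orP[/eqP i_eq|].
    by move: x_neq_y; rewrite -yE -xi i_eq eqxx.
  by rewrite ltnS => /x_far/eqP; rewrite xi.
have subz j k : j < k -> k < i -> (s ^+ j) z <> (s ^+ k) z.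
  move=> lt_jk lt_ki jk; have : (s ^+ (j + (i - k))) z = x.
    by rewrite expgD permM jk -permM -expgD subnKC ?xi // ltnW.
  by move/i_min; lia.
have stepE j : s ((s ^+ j) z) = (s ^+ j.+1) z by rewrite expgSr permM.
have ne_x j : j < i -> x != (s ^+ j) z.
  by move=> lt_ji; apply/eqP => /esym/i_min; lia.
have ne_z j : 0 < j -> j < i -> z != (s ^+ j) z.
  by move=> j0 ji; apply/eqP; have := @subz 0 j; rewrite expg0 perm1; apply.
have sE j : j.+1 < i -> j != r -> (s * t) ((s ^+ j) z) = (s ^+ j.+1) z.
  move=> lt_ji ne_jr; rewrite permM stepE /t permM.
  have ne_y : y != (s ^+ j.+1) z.
    rewrite -yE; apply/eqP; have [lt|lt|e] := ltngtP j r.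
    - by move=> /esym; apply: subz.
    - by apply: subz.
    - by rewrite e eqxx in ne_jr.
  by rewrite !tpermD ?ne_x ?ne_z.
have chain b j : (forall l, l < j -> b + l != r)%N -> b + j < i ->
    porbit (s * t) ((s ^+ (b + j)) z) = porbit (s * t) ((s ^+ b) z).
  elim: j => [|j IHj] ne_r lt_ji; first by rewrite addn0.
  rewrite addnS -(@sE (b + j)) ?porbit_apply; [|lia|exact: ne_r].
  by apply: IHj => [l lt_lj|]; [rewrite ne_r // ltnW | lia].
have az : porbit (s * t) a = porbit (s * t) z.
  have := chain 0 r; rewrite add0n expg0 perm1 za; apply; lia.
have x_neq_z : x != z by have := ne_x 0; rewrite expg0 perm1; apply; lia.
have y_neq_z : y != z by rewrite eq_sym -yE ne_z.
have xa1 : porbit (s * t) x = porbit (s * t) a.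
  rewrite -[RHS]porbit_apply; congr (porbit _ _).
  by rewrite !permM tpermL tpermD // eq_sym.
have ya1 : porbit (s * t) y = porbit (s * t) a.
  have := chain r.+1 (i - r.+2)%N; rewrite yE => <- //; try lia.
  rewrite az -[LHS]porbit_apply; congr (porbit _ _).
  rewrite !permM stepE -addnS (_ : r.+1 + _ = i)%N; last by lia.
  by rewrite xi tpermR tpermL.
apply/eqP; rewrite eqEsubset; apply/andP; split; apply/subsetP => v.
  apply: porbit_stable; first exact: porbit_id.
  have za1 : z \in porbit s a by rewrite -za porbit_sym mem_porbit.
  have ya : y \in porbit s a by rewrite -eq_porbit_mem porbit_apply.
  move=> u ua; have {}ua : s u \in porbit s a.
    by rewrite -eq_porbit_mem porbit_apply eq_porbit_mem.
  have stA w1 w2 x1 : w1 \in porbit s a -> w2 \in porbit s a -> x1 \in porbit s a ->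
      tperm w1 w2 x1 \in porbit s a by move=> ? ? ?; case: tpermP.
  by rewrite !permM !stA.
(* Conversely, the new orbit is closed under [s]: [s u] is fixed by the 3-cycle or is one of [y],
   [x], [z], which all lie in it. *)
apply: porbit_stable; first exact: porbit_id.
move=> u; rewrite -!eq_porbit_mem => /eqP uE; apply/eqP.
have := porbit_apply (s * t) u; rewrite uE !permM => suE.
have [->|/eqP ny] := eqVneq (s u) y; first exact: ya1.
have [->|/eqP nx] := eqVneq (s u) x; first exact: xa1.
have [->|/eqP nz] := eqVneq (s u) z; first exact/esym/az.
by move: suE; rewrite !tpermD //; apply/eqP => /esym.
Qed.
End Switch.

(** * Rotation systems as single permutations of the darts *)

Section Rotations.
Local Open Scope group_scope.

Lemma eq_in_porbit (T : finType) (s t : {perm T}) x :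
  {in porbit s x, s =1 t} -> porbit t x = porbit s x.
Proof.
move=> st; have E i : (t ^+ i) x = (s ^+ i) x.
  elim: i => [|i IHi]; first by rewrite !expg0.
  by rewrite !expgSr !permM IHi st ?mem_porbit.
by apply/setP => y; apply/porbitP/porbitP => -[i ->]; exists i; rewrite E.
Qed.

Variable G : sgraph.
Implicit Types (d e x : dart G) (s : {perm dart G}).

Definition tail d : G := (val d).1.
Definition head d : G := (val d).2.

Lemma in_darts_at v d : (d \in darts_at v) = (tail d == v).
Proof. by rewrite inE. Qed.

Lemma dart_inv_tail d : tail (dart_inv G d) = head d.
Proof. by rewrite permE. Qed.

Lemma dart_inv_head d : head (dart_inv G d) = tail d.
Proof. by rewrite permE. Qed.

(* A rotation system is determined by the product of its local rotations. *)
Definition rotations : {set {perm dart G}} :=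
  [set s | [forall d, porbit s d == darts_at (tail d)]].

Lemma rotationsP s :
  reflect (forall d, porbit s d = darts_at (tail d)) (s \in rotations).
Proof. by rewrite inE; apply: (iffP forallP) => H d; apply/eqP. Qed.

Lemma rotation_tail s d : s \in rotations -> tail (s d) = tail d.
Proof.
move/rotationsP/(_ d) => sd; apply/eqP; rewrite -in_darts_at -sd.
by rewrite -eq_porbit_mem porbit_apply.
Qed.

Lemma rotation_permE (rho : {ffun G -> {perm dart G}}) d :
  is_rotation_system rho -> rotation_perm rho d = rho (tail d) d.
Proof.
move=> /forallP rhoP; have rho_on v : perm_on (darts_at v) (rho v).
  by have /andP[] := rhoP v.
have rho_out v e : tail e != v -> rho v e = e.
  by move=> ev; rewrite (out_perm (rho_on v)) // in_darts_at.
have rho_tail v e : tail (rho v e) = tail e.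
  have [ev|/rho_out->//] := eqVneq (tail e) v.
  by apply/eqP; rewrite ev -in_darts_at perm_closed // in_darts_at ev.
suff main (r : seq G) e : uniq r -> (\prod_(v <- r) rho v) e =
    if tail e \in r then rho (tail e) e else e.
  by rewrite /rotation_perm main ?mem_index_enum ?index_enum_uniq.
elim: r e => [|v r IHr] e; first by rewrite big_nil perm1.
rewrite /= big_cons permM inE => /andP[v_r /IHr->]; rewrite rho_tail.
have [ev|ev] := eqVneq (tail e) v; first by rewrite ev (negPf v_r).
by rewrite (rho_out v e).
Qed.

Definition restr_rotation s : {ffun G -> {perm dart G}} :=
  [ffun v => restr_perm (darts_at v) s].

Lemma restr_rotationE s d v : s \in rotations ->
  restr_rotation s v d = if tail d == v then s d else d.
Proof.
move=> s_rot; rewrite ffunE; case: ifP => dv; last first.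
  by rewrite (out_perm (restr_perm_on _ _)) // in_darts_at dv.
rewrite restr_permE ?in_darts_at //; apply/astabsP => e /=.
by rewrite !in_darts_at apermE rotation_tail.
Qed.

Lemma restr_rotation_system s :
  s \in rotations -> is_rotation_system (restr_rotation s).
Proof.
move=> s_rot; apply/forallP => v; apply/andP; split.
  by rewrite ffunE; apply: restr_perm_on.
apply/forallP => d; apply/implyP; rewrite in_darts_at => /eqP dv; apply/eqP.
have /rotationsP/(_ d) sd := s_rot; rewrite -dv -sd.
apply: eq_in_porbit => e; rewrite sd in_darts_at => ed.
by rewrite restr_rotationE // ed.
Qed.

(** The right-hand side is the domain that [reindex_onto] produces in [sum_rotation_systems]. *)
Lemma is_rotation_systemE (rho : {ffun G -> {perm dart G}}) :
  is_rotation_system rho = (rotation_perm rho \in rotations)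
    && (restr_rotation (rotation_perm rho) == rho).
Proof.
apply/idP/andP => [rho_rot|[s_rot /eqP <-]]; last exact: restr_rotation_system.
  have rhoE := rotation_permE _ rho_rot.
  have /forallP rhoP := rho_rot.
  have s_rot : rotation_perm rho \in rotations.
    apply/rotationsP => d; have /andP[on_v /forallP/(_ d)] := rhoP (tail d).
    rewrite in_darts_at eqxx => /eqP dE; rewrite -dE.
    apply: eq_in_porbit => e; rewrite dE in_darts_at => /eqP ed.
    by rewrite rhoE ed.
  split=> //; apply/eqP/ffunP => v; apply/permP => d.
  rewrite restr_rotationE // rhoE; case: eqVneq => [->//|dv].
  by have /andP[/out_perm->] := rhoP v; rewrite // in_darts_at.
Qed.

Lemma restr_rotationK s : s \in rotations -> rotation_perm (restr_rotation s) = s.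
Proof.
move=> s_rot; apply/permP => d.
by rewrite rotation_permE ?restr_rotationE ?eqxx ?restr_rotation_system.
Qed.

Lemma sum_rotation_systems (V : nmodType) (f : {perm dart G} -> V) :
  (\sum_(rho in rotation_systems G) f (rotation_perm rho)
     = \sum_(s in rotations) f s)%R.
Proof.
rewrite [RHS](reindex_onto (@rotation_perm G) restr_rotation); last first.
  exact: restr_rotationK.
by apply: eq_bigl => rho; rewrite inE is_rotation_systemE.
Qed.

End Rotations.

(** * Rotations that follow a given face trail *)

Section Trails.
Local Open Scope group_scope.
Variable G : sgraph.
Implicit Types (d e x : dart G) (r : seq (dart G)) (s : {perm dart G}).

Definition face_perm s : {perm dart G} := dart_inv G * s.

Lemma face_permE s d : face_perm s d = s (dart_inv G d).
Proof. exact: permM. Qed.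

Lemma face_perm_tail s d : s \in rotations G -> tail (face_perm s d) = head d.
Proof. by move=> s_rot; rewrite face_permE rotation_tail // dart_inv_tail. Qed.

Definition following d r : {set {perm dart G}} :=
  [set s in rotations G | fpath (face_perm s) d r].

Lemma following_rcons d r x s : s \in following d (rcons r x) =
  (s \in following d r) && (face_perm s (last d r) == x).
Proof. by rewrite !inE rcons_path andbA. Qed.

Lemma following_predecessor d r s s0 x :
    fpath (face_perm s) d r -> fpath (face_perm s0) d r -> x \in r ->
  exists2 e, e \in belast d r & face_perm s e = x /\ face_perm s0 e = x.
Proof.
elim: r d => //= y r IHr d /andP[/eqP sd sr] /andP[/eqP s0d s0r].
rewrite inE => /orP[/eqP->|/(IHr _ sr s0r)[e er eP]].
  by exists d; rewrite ?mem_head.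
by exists e; rewrite // inE er orbT.
Qed.

(** The darts of [r] already have their predecessors on the trail, so by injectivity the only old
    dart that can come next is [d]. *)
Lemma trail_last_new d r s : uniq (d :: r) -> s \in following d r ->
  face_perm s (last d r) \notin r.
Proof.
rewrite lastI rcons_uniq inE => /andP[last_new _] /andP[_ sr].
apply/negP => /(following_predecessor sr sr)[e er [/perm_inj eE _]].
by rewrite -eE er in last_new.
Qed.

Lemma following_mul d r s (t : {perm dart G}) : {in r, t =1 id} ->
  fpath (face_perm s) d r -> fpath (face_perm (s * t)) d r.
Proof.
elim: r d => //= y r IHr d tr /andP[/eqP sd /IHr->]; last first.
  by move=> u ur; rewrite tr // inE ur orbT.
by rewrite face_permE permM -face_permE sd tr ?mem_head ?eqxx.
Qed.

(* The darts of r are the values already prescribed for the rotation s, and z *)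
(* is the start of the maximal prescribed block ending at the next argument   *)
(* dart_inv (last d r): z is the one value that would close a cycle of s      *)
(* inside the prescribed part. Exchanging the two blocks after this argument, *)
(* a product by a 3-cycle, redirects the next value from x to x'.             *)
Lemma following_le d r : uniq (d :: r) ->
  exists2 z, z \in map (dart_inv G) (d :: r) &
    forall x x', tail x' = head (last d r) -> x' \notin r -> x' != z ->
      #|following d (rcons r x)| <= #|following d (rcons r x')|.
Proof.
move=> dr_uniq; set a := dart_inv G (last d r).
have [no_s|[s0 s0P]] := set_0Vmem (following d r).
  exists (dart_inv G d) => [|x x' _ _ _]; first exact: mem_head.
  rewrite (_ : following d (rcons r x) = set0) ?cards0 //.
  by apply/setP => s; rewrite following_rcons no_s !inE.
have /setIdP[s0_rot s0r] := s0P.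
(* Going backward from [a] under [s0], the first point [w m] outside [r] is the required [z]. It
   exists because [s0 a] lies on the cycle of [a] but not in [r]. *)
pose w i := (s0^-1 ^+ i) a.
have s0w i : s0 (w i.+1) = w i by rewrite /w expgSr permM permKV.
have [m wm w_lt] : exists2 m, w m \notin r & forall i, i < m -> w i \in r.
  have ex_m : exists m, w m \notin r.
    have /porbitP[m wE] : s0 a \in porbit s0^-1 a.
      by rewrite porbitV -eq_porbit_mem porbit_apply.
    by exists m; rewrite /w -wE -face_permE trail_last_new.
  case: (ex_minnP ex_m) => m wm m_min; exists m => // i; apply: contraLR.
  by rewrite -leqNgt; apply: m_min.
exists (w m).
  case: m wm w_lt => [|m] wm w_lt.
    by rewrite /w expg0 perm1 map_f // mem_last.
  have [e er [_ eE]] := following_predecessor s0r s0r (w_lt m (ltnSn m)).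
  suff -> : w m.+1 = dart_inv G e by rewrite map_f // mem_belast.
  by apply: (@perm_inj _ s0); rewrite s0w -face_permE.
move=> x x' x'_tail x'r x'z; have [->//|x'x] := eqVneq x' x.
pose t := tperm x x' * tperm x (w m).
rewrite -(card_imset _ (mulIg t)); apply/subset_leq_card/subsetP => y /imsetP[s].
rewrite following_rcons => /andP[sP /eqP sx] ->.
have /setIdP[s_rot sr] := sP.
have sa : s a = x by rewrite -face_permE.
(* The values met on the way are prescribed, so every [s] in [following d r] agrees with [s0] there:
   [z] does not depend on [s]. *)
have sw i : i < m -> s (w i.+1) = w i.
  move=> /w_lt wr; have [e _ []] := following_predecessor sr s0r wr.
  rewrite !face_permE => se s0e; rewrite -se; congr (s _).
  by apply: (@perm_inj _ s0); rewrite s0w.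
have spow i : i <= m -> (s ^+ i) (w m) = w (m - i).
  elim: i => [|i IHi] lt_im; first by rewrite expg0 perm1 subn0.
  by rewrite expgSr permM IHi 1?ltnW // -(subnSK lt_im) sw //; lia.
have aE : (s ^+ m) (w m) = a by rewrite spow // subnn /w expg0 perm1.
have w_x' i : i <= m -> w i != x'.
  rewrite leq_eqVlt => /orP[/eqP->|/w_lt wr]; first by rewrite eq_sym.
  by apply: contraNneq x'r => <-.
have x'a : x' \in porbit s a.
  move/rotationsP: s_rot => ->; rewrite in_darts_at x'_tail.
  by rewrite dart_inv_tail.
have xr : x \notin r by rewrite -sx trail_last_new.
have wa : w m \in porbit s a by rewrite porbit_sym -aE mem_porbit.
have xa : x \in porbit s a by rewrite -sa -eq_porbit_mem porbit_apply.
have st_a : porbit (s * t) a = porbit s a.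
  rewrite /t -sa; apply: (porbit_switch aE); rewrite ?sa // => i lt_im.
  by rewrite spow // w_x' // leq_subr.
have st_rot : s * t \in rotations G.
  move/rotationsP: (s_rot) => s_orb; apply/rotationsP => e.
  have [ea|ea] := boolP (e \in porbit s a).
    move: (ea); rewrite -eq_porbit_mem => /eqP ea'.
    rewrite -s_orb ea' -st_a; apply/eqP.
    by rewrite eq_porbit_mem st_a.
  rewrite -s_orb; apply: eq_in_porbit => c ce; rewrite permM.
  have sc : s c \notin porbit s a.
    apply: contra ea; rewrite -eq_porbit_mem porbit_apply eq_porbit_mem => ca.
    by move: ce; rewrite -!eq_porbit_mem => /eqP <-; rewrite eq_porbit_mem.
  by rewrite permM !tpermD //; apply: contraNneq sc => <-.
rewrite following_rcons inE st_rot following_mul //=; last first.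
  move=> u ur; rewrite permM !tpermD //; apply: contraTneq ur => <- //.
by rewrite face_permE permM sa permM tpermL tpermD // eq_sym.
Qed.
End Trails.

Lemma uniq_codepth_lt (T : finType) (d x : T) r : uniq (x :: d :: r) ->
  (#|T| - size (rcons r x) < #|T| - size r)%N.
Proof.
move=> xdr_uniq; have : (size (x :: d :: r) <= #|T|)%N.
  by rewrite -(card_uniqP xdr_uniq) max_card.
by rewrite size_rcons /= => lt_r; apply: ltn_sub2l => //; apply: ltnW.
Qed.

Local Open Scope ring_scope.

(** * Counting cycles by weights *)

Section TopWeight.
Variable F : numFieldType.

(* Every cycle of s gets total weight 1, spread evenly over the points of the *)
(* cycle at which h is maximal.                                               *)
Definition top_weight (T : finType) (h : T -> nat) (s : {perm T}) (x : T) : F :=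
  if [forall y in porbit s x, (h y <= h x)%N] then
    #|[set y in porbit s x | h y == h x]|%:R^-1 else 0.

Lemma sum_top_weight (T : finType) (h : T -> nat) (s : {perm T}) :
  \sum_x top_weight h s x = #|porbits s|%:R.
Proof.
rewrite (partition_big_imset (porbit s)) /= -sum1_card natr_sum.
apply: eq_bigr => _ /imsetP[x0 _ ->].
have [m m_in m_max] := arg_maxnP h (porbit_id s x0).
have {m_in} mx0 : m \in porbit s x0 by [].
(* Within one cycle only the maximizers of [h] contribute, each the inverse of their number. *)
set B := [set y in porbit s x0 | h y == h m].
rewrite (eq_bigr (fun x => if x \in B then #|B|%:R^-1 else 0)) => [|x]; last first.
  move=> /eqP xx0; have xin : x \in porbit s x0 by rewrite -xx0 porbit_id.
  rewrite /top_weight xx0 inE xin /=.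
  have [xm|xm] := eqVneq (h x) (h m).
    by rewrite xm ifT //; apply/forall_inP => y /m_max.
  rewrite ifF //; apply/forall_inP => /(_ m mx0) le_mx.
  case/eqP: xm; apply/eqP; rewrite eqn_leq le_mx andbT.
  by exact: m_max.
rewrite -big_mkcondr /= (eq_bigl (mem B)) => [|x]; last first.
  by rewrite inE eq_porbit_mem !inE andbA andbb.
rewrite sumr_const -[RHS](@mulVf _ #|B|%:R) ?mulr_natr //.
by rewrite pnatr_eq0 -lt0n; apply/card_gt0P; exists m; rewrite inE mx0 eqxx.
Qed.

End TopWeight.

(** * Trails and weights in the complete graph *)

Section CompleteGraph.
Variables (n : nat) (F : realFieldType).
Notation K := (complete_graph n).
Implicit Types (d e x : dart K) (r : seq (dart K)) (s : {perm dart K}).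

Definition src d : 'I_n := tail d.
Definition dst d : 'I_n := head d.

Lemma src_neq_dst d : src d != dst d.
Proof. exact: valP d. Qed.

Lemma dart_eq d e : src d = src e -> dst d = dst e -> d = e.
Proof.
case: d e => [[u v] uv] [[u' v'] uv']; rewrite /src /dst /tail /head /= => uu' vv'.
by apply: val_inj; rewrite /= uu' vv'.
Qed.

Lemma dst_inj_at (v : 'I_n) : {in [pred d | src d == v] &, injective dst}.
Proof. by move=> d e; rewrite !inE => /eqP dv /eqP ev; apply: dart_eq; rewrite dv. Qed.

Lemma dart_ex (u v : 'I_n) : u != v -> exists d, src d = u /\ dst d = v.
Proof. by move=> uv; exists (exist _ (u, v) uv). Qed.

Lemma card_darts_to (v : 'I_n) (P : pred 'I_n) : ~~ P v ->
  #|[set d | (src d == v) && P (dst d)]| = #|P|.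
Proof.
move=> Pv; rewrite -(@card_in_imset _ _ dst) => [|d e]; last first.
  by rewrite !inE => /andP[dv _] /andP[ev _]; apply: (@dst_inj_at v).
apply: eq_card => u; apply/imsetP/idP => [[d]|Pu].
  by rewrite inE => /andP[_ ?] ->.
have [|d [dv du]] := @dart_ex v u; first by apply: contraNneq Pv => ->.
by exists d; rewrite // inE dv du eqxx.
Qed.

Lemma card_darts_at (v : 'I_n) : #|[set d | src d == v]| = n.-1.
Proof.
have -> : n.-1 = #|predC1 v| by rewrite cardC1 card_ord.
rewrite -(@card_darts_to v (predC1 v)) ?inE ?eqxx //.
apply: eq_card => d; rewrite !inE; case: eqP => //= <-.
by rewrite eq_sym src_neq_dst.
Qed.

Lemma card_ord_gt (k : 'I_n) : #|[pred i : 'I_n | (k < i)%N]| = (n - k.+1)%N.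
Proof.
rewrite -sum1_card big_mkcond /=; elim: n (nat_of_ord k) => [|m IHm] j.
  by rewrite big_ord0.
by rewrite big_ord_recr /= IHm inE /=; case: ifP; lia.
Qed.


Definition weight d s : F := top_weight F src (face_perm s) d.

Lemma mem_following_porbit d r s :
  s \in following d r -> {subset d :: r <= porbit (face_perm s) d}.
Proof.
case/setIdP => _; elim: r d => [|y r IHr] d /=.
  by move=> _ x; rewrite inE => /eqP->; apply: porbit_id.
case/andP => /eqP <- /IHr sub x; rewrite inE => /predU1P[->|/sub].
  exact: porbit_id.
by rewrite porbit_apply.
Qed.

Lemma weight_closed d r s : uniq (d :: r) ->
    all (fun x => src x <= src d)%N (d :: r) ->
    s \in following d (rcons r d) ->
  weight d s = (count (fun x => src x == src d) (d :: r))%:R^-1.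
Proof.
move=> dr_uniq /allP dr_le sP.
have orbE : porbit (face_perm s) d =i d :: r.
  move=> y; apply/idP/idP => [|yr]; last first.
    have : s \in following d r by move: sP; rewrite following_rcons => /andP[].
    by move/mem_following_porbit; apply.
  apply: porbit_stable; first exact: mem_head.
  move=> x xr.
  have /setIdP[_ cyc] := sP.
  have {}cyc : fcycle (face_perm s) (d :: r) by [].
  have /eqP -> := next_cycle cyc xr.
  by rewrite mem_next.
rewrite /weight /top_weight ifT; last by apply/forall_inP => x; rewrite orbE => /dr_le.
congr (_%:R^-1); rewrite -size_filter -(card_uniqP _) ?filter_uniq //.
by apply: eq_card => x; rewrite inE orbE mem_filter andbC.
Qed.

Lemma weight_exit d r s :
  s \in following d r -> (src d < dst (last d r))%N -> weight d s = 0.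
Proof.
move=> sP lt_d; rewrite /weight /top_weight ifF //; apply/forall_inP.
have /setIdP[s_rot _] := sP.
move/(_ (face_perm s (last d r))); rewrite -eq_porbit_mem porbit_apply eq_porbit_mem.
rewrite (mem_following_porbit sP) ?mem_last // => /(_ isT).
by rewrite /src face_perm_tail // leqNgt lt_d.
Qed.

Lemma sum_following (f : {perm dart K} -> F) d r :
  \sum_(s in following d r) f s
    = \sum_x \sum_(s in following d (rcons r x)) f s.
Proof.
rewrite (partition_big (fun s => face_perm s (last d r)) xpredT) //=.
by apply: eq_bigr => x _; apply: eq_bigl => s; rewrite following_rcons.
Qed.

Lemma card_following d r :
  #|following d r|%:R = \sum_x #|following d (rcons r x)|%:R :> F.
Proof.
rewrite -sum1_card natr_sum sum_following; apply: eq_bigr => x _.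
by rewrite -natr_sum sum1_card.
Qed.

Lemma following_src d r x : #|following d (rcons r x)| != 0%N -> src x = dst (last d r).
Proof.
rewrite -lt0n => /card_gt0P[s]; rewrite following_rcons.
by case/andP => /setIdP[s_rot _] /eqP <-; rewrite /src face_perm_tail.
Qed.


(** By [following_le], every dart at the vertex of [x] outside [r], except [z], is at least as
    frequent as [x]; the successor in the factor allows for [z]. *)
Lemma following_close_le d r x : uniq (d :: r) -> src x = dst (last d r) ->
  ((n.-1 - (count (fun y => src y == src x) r).+1) * #|following d (rcons r x)|
     <= #|following d r|)%N.
Proof.
move=> dr_uniq x_src; have [z _ zP] := following_le dr_uniq.
set v := src x; set c := #|following d (rcons r x)|.
set A := [set y | src y == v] :\: [set y in r | src y == v] :\ z.
have le_cA : (#|A| * c <= #|following d r|)%N.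
  have -> : (#|following d r| = \sum_y #|following d (rcons r y)|)%N.
    by apply/eqP; rewrite -(eqr_nat F) card_following natr_sum.
  rewrite (bigID (mem A)) /= -sum_nat_const.
  apply: leq_trans (leq_addr _ _); apply: leq_sum => y.
  rewrite !inE => /andP[yz /andP[yr /eqP yv]].
  by apply: zP => //; [rewrite -[RHS]x_src -/v -yv | rewrite yv eqxx andbT in yr].
apply: leq_trans le_cA; rewrite leq_mul2r; apply/orP; right.
have cr : (#|[set y in r | src y == v]| <= count (fun y => src y == v) r)%N.
  rewrite -size_filter; apply: leq_trans (card_size _).
  by apply/subset_leq_card/subsetP => y; rewrite inE mem_filter andbC.
have := cardsD1 z ([set y | src y == v] :\: [set y in r | src y == v]).
rewrite -/A cardsD card_darts_at => e.
have := subset_leq_card (subsetIr [set y | src y == v] [set y in r | src y == v]).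
by move: e cr; case: (z \in _) => /=; lia.
Qed.

(** The exceptional [z] is a reversed dart of the trail, so it heads to a visited vertex, whereas
    [e] does not. *)
Lemma following_exit_le d r x e : uniq (d :: r) ->
    src e = dst (last d r) -> e \notin r ->
    (forall y, y \in d :: r -> src y != dst e) ->
  (#|following d (rcons r x)| <= #|following d (rcons r e)|)%N.
Proof.
move=> dr_uniq e_src er e_new; have [z z_in zP] := following_le dr_uniq.
apply: zP => //; apply: contraTneq z_in => <-; apply/mapP => -[y yr ey].
have := e_new y yr; rewrite ey.
have -> : dst (dart_inv K y) = src y by rewrite /dst dart_inv_head.
by rewrite eqxx.
Qed.


Lemma following_seen d r x : uniq (d :: r) -> x \in r ->
  following d (rcons r x) = set0.
Proof.
move=> dr_uniq xr; apply/setP => s; rewrite following_rcons in_set0.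
apply/negP => /andP[/(trail_last_new dr_uniq) new_x /eqP x_eq].
by rewrite x_eq xr in new_x.
Qed.

Lemma card_visits d r (v : 'I_n) : uniq (d :: r) ->
  #|[set x in d :: r | src x == v]| = count (fun x => src x == v) (d :: r).
Proof.
move=> dr_uniq; rewrite -size_filter -(card_uniqP _) ?filter_uniq //.
by apply: eq_card => x; rewrite inE mem_filter andbC.
Qed.

Lemma visits_subset d r (v : 'I_n) :
  [set x in d :: r | src x == v] \subset [set x | src x == v].
Proof. by apply/subsetP => x; rewrite !inE => /andP[]. Qed.

Lemma visits_le d r (v : 'I_n) : uniq (d :: r) ->
  (count (fun x => src x == v) (d :: r) <= n.-1)%N.
Proof.
move=> dr_uniq; rewrite -(card_darts_at v) -card_visits //.
exact/subset_leq_card/visits_subset.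
Qed.

Lemma visits_full d r x : uniq (d :: r) ->
    count (fun y => src y == src x) (d :: r) = n.-1 ->
  x \in d :: r.
Proof.
move=> dr_uniq full.
have /eqP/setP/(_ x) :
    [set y in d :: r | src y == src x] == [set y | src y == src x].
  by rewrite eqEcard visits_subset card_visits // full card_darts_at leqnn.
by rewrite !in_set eqxx andbT => ->.
Qed.

Lemma following_dst_le d r s (j : nat) : s \in following d r ->
    all (fun x => src x <= j)%N (d :: r) -> (dst (last d r) <= j)%N ->
  all (fun x => dst x <= j)%N (d :: r).
Proof.
case/setIdP => s_rot; elim: r d => [|y r IHr] d /=; first by move=> _ _ ->.
case/andP => /eqP sd sr /and3P[_ yj rj] last_j; apply/andP; split.
  by move: yj; rewrite -sd /src face_perm_tail.
by apply: IHr => //=; rewrite yj.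
Qed.

(* The trail stops at a dart heading to k, or at one heading to a vertex that *)
(* precedes k. In the second case it has to return to k before closing, which *)
(* costs the factor q; b t bounds the mean weight on arrival at k after t     *)
(* visits.                                                                    *)
Section TrailBound.
Variables (d : dart K) (b : nat -> F).
Let k := src d.
Let q : F := (n - k.+1).+1%:R^-1.
Let visits r := count (fun x => src x == k) (d :: r).
Let value r : F := \sum_(s in following d r) weight d s.
Let num r : F := #|following d r|%:R.
Let pot r : F := if dst (last d r) == k then b (visits r) else q * b (visits r).

Hypothesis b_ge0 : forall t, 0 <= b t.
(** After [t] visits the face closes with chance at most 1/(n-1-t) and then weighs 1/t; otherwise it
    goes on with [t.+1] visits and must return, at cost [q]. *)
Hypothesis b_step : forall t, (0 < t < n.-1)%N ->
  (t%:R * (n.-1 - t)%:R)^-1 + q * b t.+1 <= b t.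
Hypothesis b_last : n.-1%:R^-1 <= b n.-1.

Let q_ge0 : 0 <= q. Proof. by rewrite invr_ge0 ler0n. Qed.
Let num_ge0 r : 0 <= num r. Proof. exact: ler0n. Qed.
Let pot_ge0 r : 0 <= pot r.
Proof. by rewrite /pot; case: ifP => _; rewrite ?mulr_ge0. Qed.

Let value0 r : num r = 0 -> value r = 0.
Proof.
move/eqP; rewrite pnatr_eq0 cards_eq0 => /eqP r0.
by rewrite /value r0 big_set0.
Qed.

Let visits_rcons r x : visits (rcons r x) = (visits r + (src x == k))%N.
Proof. by rewrite /visits -rcons_cons -cats1 count_cat /= addn0. Qed.

Let num_src r x : src x != dst (last d r) -> num (rcons r x) = 0.
Proof.
by move=> x_src; apply: contraNeq x_src; rewrite pnatr_eq0 => /following_src->.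
Qed.

Let value_exit r : (k < dst (last d r))%N -> value r = 0.
Proof. by move=> lt_k; rewrite /value big1 // => s /weight_exit->. Qed.

Let extension_bound r :=
  forall x, x \notin d :: r -> num (rcons r x) != 0 ->
  value (rcons r x) <= pot (rcons r x) * num (rcons r x).

Let num_seen r x : uniq (d :: r) -> x \in r -> num (rcons r x) = 0.
Proof. by move=> dr_uniq xr; rewrite /num following_seen // cards0. Qed.

(* At a return to k, at most a fraction 1/(n-1-t) of the rotations closes the *)
(* face, where t is the number of visits to k.                                *)
Let return_bound r : uniq (d :: r) ->
    all (fun x => src x <= k)%N (d :: r) -> extension_bound r ->
  dst (last d r) = k -> value r <= b (visits r) * num r.
Proof.
move=> dr_uniq dr_le ext last_k; set t := visits r.
have value_d : value (rcons r d) = t%:R^-1 * num (rcons r d).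
  rewrite /value (eq_bigr (fun _ => t%:R^-1)) => [|s sP]; last first.
    exact: weight_closed sP.
  by rewrite sumr_const mulr_natr.
have value_x x : x != d -> value (rcons r x) <= q * b t.+1 * num (rcons r x).
  move=> xd; have [n0|n0] := eqVneq (num (rcons r x)) 0.
    by rewrite value0 // n0 mulr0.
  have x_new : x \notin d :: r.
    rewrite inE (negPf xd); apply: contraNN n0 => /(num_seen dr_uniq) ->.
    by rewrite eqxx.
  have x_src : src x = k.
    by rewrite -last_k; apply: following_src; rewrite pnatr_eq0 in n0.
  (* A dart at [k] cannot head to [k], so the second case of [pot] applies. *)
  have := ext x x_new n0; rewrite /pot last_rcons visits_rcons x_src eqxx addn1.
  by rewrite -x_src eq_sym (negPf (src_neq_dst x)).
have -> : value r = value (rcons r d) + \sum_(x | x != d) value (rcons r x).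
  by rewrite /value sum_following (bigD1 d).
have numE : num r = num (rcons r d) + \sum_(x | x != d) num (rcons r x).
  by rewrite /num card_following (bigD1 d).
have t_gt0 : (0 < t)%N by rewrite /t /visits /= eqxx.
have := visits_le k dr_uniq; rewrite -/(visits r) -/t leq_eqVlt.
case/orP => [/eqP t_last|lt_t].
  (* All darts at k have been used, so that the face has to close. *)
  have -> : \sum_(x | x != d) value (rcons r x) = 0.
    apply: big1 => x xd; apply: value0; have [xk|xk] := eqVneq (src x) k; last first.
      by apply: num_src; rewrite last_k.
    have := @visits_full d r x dr_uniq; rewrite xk => /(_ t_last).
    by rewrite inE (negPf xd) => /(num_seen dr_uniq).
  rewrite addr0 value_d t_last; apply: ler_pM; rewrite ?invr_ge0 ?ler0n //.
  by rewrite numE lerDl sumr_ge0.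
apply: (@le_trans _ _ ((t%:R * (n.-1 - t)%:R)^-1 * num r + q * b t.+1 * num r)).
  apply: lerD.
    rewrite value_d invfM -mulrA ler_wpM2l ?invr_ge0 ?ler0n //.
    rewrite ler_pdivlMl ?ltr0n ?subn_gt0 // -natrM ler_nat.
    have := @following_close_le d r d dr_uniq (esym last_k).
    by rewrite -/k /t /visits /= eqxx.
  rewrite numE mulrDr mulr_sumr; apply: ler_wpDl; first by rewrite !mulr_ge0.
  exact: ler_sum.
by rewrite -mulrDl ler_wpM2r // b_step // t_gt0.
Qed.


(* At a vertex v before k, at most one dart leads to k while n - k.+1 unused  *)
(* darts lead beyond k, and each of these is at least as likely to come next. *)
Let passage_bound r : uniq (d :: r) ->
    all (fun x => src x <= k)%N (d :: r) -> extension_bound r ->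
  (dst (last d r) < k)%N -> value r <= q * b (visits r) * num r.
Proof.
move=> dr_uniq dr_le ext; set v := dst (last d r) => lt_vk; set t := visits r.
have [r0|[s sP]] := set_0Vmem (following d r).
  by rewrite value0 /num r0 cards0 // mulr0.
have /allP dr_dst := following_dst_le sP dr_le (ltnW lt_vk).
have [|d0 [d0v d0k]] := @dart_ex v k; first by rewrite -val_eqE /=; lia.
set c0 := num (rcons r d0).
pose exit x := (src x == v) && (k < dst x)%N.
have exit_le x : exit x -> c0 <= num (rcons r x).
  move=> /andP[/eqP xv lt_kx]; rewrite ler_nat; apply: following_exit_le => //.
    apply/negP => xr; have := dr_dst x; rewrite inE xr orbT => /(_ isT).
    by rewrite leqNgt lt_kx.
  move=> y /(allP dr_le) => le_yk; apply: contraTneq le_yk => ->.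
  by rewrite -ltnNge.
(* Each next dart gets the baseline [q * b t], raised to [b t] at the dart [d0] to [k] and lowered
   to 0 at exits. There are [n - k.+1] exits, each at least as frequent as [d0], so by [q_eq] the
   corrections add up to at most 0. *)
pose bound x := q * b t * num (rcons r x)
    + (if x == d0 then (b t - q * b t) * c0 else 0)
    - (if exit x then q * b t * num (rcons r x) else 0).
have qb_ge0 : 0 <= q * b t by rewrite mulr_ge0.
have bq_ge0 : 0 <= (b t - q * b t) * c0.
  apply: mulr_ge0 => //; rewrite subr_ge0 ler_piMl //.
  by rewrite invf_le1 ?ltr0n // ler1n.
have value_x x : value (rcons r x) <= bound x.
  rewrite /bound; have [n0|n0] := eqVneq (num (rcons r x)) 0.
    by rewrite value0 // n0 mulr0 if_same subr0 add0r; case: ifP.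
  have xv : src x = v by apply: following_src; rewrite pnatr_eq0 in n0.
  have xk : (src x == k) = false by rewrite xv -val_eqE /= ltn_eqF.
  have x_new : x \notin d :: r.
    rewrite inE negb_or; apply/andP; split.
      by apply: contraFneq xk => ->.
    by apply: contraNN n0 => /(num_seen dr_uniq) ->.
  have := ext x x_new n0; rewrite /pot last_rcons visits_rcons xk addn0.
  have [lt_xk|lt_kx|/val_inj dst_xk] := ltngtP (dst x) k.
  - have -> : exit x = false by rewrite /exit ltnNge (ltnW lt_xk) andbF.
    have -> : (x == d0) = false.
      by apply: contraTF lt_xk => /eqP->; rewrite d0k ltnn.
    have -> : (dst x == k) = false by rewrite -val_eqE /= ltn_eqF.
    by rewrite addr0 subr0.
  - rewrite value_exit ?last_rcons // /exit xv eqxx lt_kx /= addrAC subrr add0r.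
    by move=> _; case: ifP.
  - have -> : x = d0 by apply: dart_eq; rewrite ?xv ?dst_xk.
    rewrite /exit d0k ltnn andbF !eqxx subr0 -/c0; congr (_ <= _).
    by rewrite mulrBl addrC subrK.
have numE : num r = \sum_x num (rcons r x) by apply: card_following.
have -> : value r = \sum_x value (rcons r x) by apply: sum_following.
apply: (@le_trans _ _ (\sum_x bound x)); first exact: ler_sum.
rewrite sumrB big_split /= -mulr_sumr -numE -!big_mkcond /= big_pred1_eq.
rewrite -addrA gerDl subr_le0 -mulr_sumr.
have exit_sum : (n - k.+1)%:R * c0 <= \sum_(x | exit x) num (rcons r x).
  rewrite -(card_ord_gt k) -(@card_darts_to v) ?inE -?leqNgt ?(ltnW lt_vk) //.
  rewrite mulr_natl -sumr_const (eq_bigl exit) => [|x]; last by rewrite inE.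
  exact: ler_sum.
apply: le_trans (ler_wpM2l _ exit_sum); last by rewrite mulr_ge0.
rewrite mulrA ler_wpM2r // -subr_ge0.
suff -> : q * b t * (n - k.+1)%:R - (b t - q * b t) = 0 by [].
have q_eq : q * (n - k.+1)%:R = 1 - q.
  rewrite /q -[X in _ * X](addrK 1) -natr1 mulrBr mulVf ?mulr1 //.
  by rewrite natr1 pnatr_eq0.
by rewrite mulrAC q_eq mulrBl mul1r subrr.
Qed.

Lemma trail_bound r : uniq (d :: r) -> all (fun x => src x <= k)%N (d :: r) ->
  value r <= pot r * num r.
Proof.
have [m] := ubnP (#|dart K| - size r); elim: m r => // m IHm r lt_m dr_uniq dr_le.
have ext : (dst (last d r) <= k)%N -> extension_bound r.
  move=> last_k x x_new n0; apply: IHm.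
  - rewrite -ltnS; apply: leq_trans lt_m; rewrite ltnS.
    by apply: (@uniq_codepth_lt _ d); rewrite cons_uniq x_new.
  - by rewrite -rcons_cons rcons_uniq x_new.
  rewrite -rcons_cons all_rcons dr_le andbT.
  by rewrite (@following_src d r) //; rewrite pnatr_eq0 in n0.
rewrite /pot; have [lt_k|lt_k|/val_inj eq_k] := ltngtP (dst (last d r)) k.
- have -> : (dst (last d r) == k) = false by rewrite -val_eqE /= ltn_eqF.
  by apply: passage_bound => //; apply: ext; apply: ltnW.
- by rewrite value_exit // mulr_ge0 // -/(pot r) pot_ge0.
- have last_k := eq_k; rewrite eq_k eqxx; apply: return_bound => //.
  by apply: ext; rewrite last_k.
Qed.

End TrailBound.



(** * Choice of the potential and summation over the darts *)

Lemma weight_bound d (b : nat -> F) (q := (n - (src d).+1).+1%:R^-1) :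
    (forall t, 0 <= b t) ->
    (forall t, (0 < t < n.-1)%N ->
       (t%:R * (n.-1 - t)%:R)^-1 + q * b t.+1 <= b t) ->
    n.-1%:R^-1 <= b n.-1 ->
  \sum_(s in rotations K) weight d s <= q * b 1%N * #|rotations K|%:R.
Proof.
move=> b_ge0 b_step b_last; have := trail_bound b_ge0 b_step b_last (r := [::]) isT.
rewrite /= leqnn => /(_ isT); rewrite eq_sym (negPf (src_neq_dst d)) eqxx addn0.
suff -> : following d [::] = rotations K by [].
by apply/setP => s; rewrite inE /= andbT.
Qed.

Lemma weight_bound_inner d (e := (n - (src d).+1)%N) : (0 < e)%N ->
  \sum_(s in rotations K) weight d s
    <= 2 / e%:R / n.-1%:R * #|rotations K|%:R.
Proof.
move=> e_gt0; have e_pos : 0 < e%:R :> F by rewrite ltr0n.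
have n_gt1 : (1 < n)%N by rewrite /e in e_gt0; lia.
have N_pos : 0 < n.-1%:R :> F by rewrite ltr0n; lia.
have e0 : e%:R != 0 :> F by rewrite gt_eqF.
have e1 : e%:R + 1 != 0 :> F by rewrite natr1 pnatr_eq0.
have N0 : n.-1%:R != 0 :> F by rewrite gt_eqF.
(* A constant potential with (1 - q) b = 2/N, where N = n - 1: the step condition becomes 1/(t (N -
   t)) <= 2/N, true since t (N - t) >= N - 1 >= N/2. *)
pose b (_ : nat) : F := 2 * e.+1%:R / (e%:R * n.-1%:R).
have bE : e.+1%:R^-1 * b 1%N = 2 / e%:R / n.-1%:R.
  by rewrite /b -natr1; field; rewrite e0 N0 ?[1 + _]addrC e1.
have b_split t u : b t = 2 / n.-1%:R + e.+1%:R^-1 * b u.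
  by rewrite /b -natr1; field; rewrite e0 N0 ?[1 + _]addrC e1.
have b_ge0 t : 0 <= b t by rewrite /b divr_ge0 ?mulr_ge0 ?ler0n.
rewrite -bE; apply: (weight_bound b_ge0); rewrite -/e.
  move=> t /andP[t_gt0 lt_t]; rewrite (b_split t t.+1) lerD2r.
  rewrite -[leLHS]mul1r ler_pdivlMr // mulrAC mul1r.
  rewrite ler_pdivrMr ?mulr_gt0 ?ltr0n ?subn_gt0 // -!natrM ler_nat.
  by have [u ->] : exists u, n.-1 = (t + u.+1)%N; [exists (n.-1 - t).-1; lia | nia].
rewrite (b_split _ 0%N) -[leLHS]addr0; apply: lerD.
  by rewrite ler_pdivlMr // mulVf // ler1n.
by apply: mulr_ge0 (b_ge0 _); rewrite invr_ge0 ler0n.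
Qed.

Lemma weight_bound_last d : (n - (src d).+1 = 0)%N ->
  \sum_(s in rotations K) weight d s
    <= (2 * (\sum_(1 <= i < n.-1) i%:R^-1) + 1) / n.-1%:R * #|rotations K|%:R.
Proof.
move=> e0; have N_gt0 : (0 < n.-1)%N.
  by have := src_neq_dst d; rewrite -val_eqE /=; case: (src d) (dst d) => [i ?] [j ?] /=; lia.
have N0 : n.-1%:R != 0 :> F by rewrite pnatr_eq0 -lt0n.
(* Here [q] is 1, and [b] solves the recursion with equality, starting from 1/(n-1) at t = n - 1. *)
pose b t : F := \sum_(t <= i < n.-1) (i%:R * (n.-1 - i)%:R)^-1 + n.-1%:R^-1.
have b_ge0 t : 0 <= b t.
  by rewrite addr_ge0 ?invr_ge0 ?ler0n ?sumr_ge0 // => i _; rewrite invr_ge0 mulr_ge0.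
have b1 : b 1%N = (2 * (\sum_(1 <= i < n.-1) i%:R^-1) + 1) / n.-1%:R.
  rewrite /b mulrDl mul1r; congr (_ + _); rewrite mulr2n mulrDl mul1r.
  (* Partial fractions, with N = n - 1: 1/(i (N - i)) = (1/i + 1/(N - i))/N. *)
  rewrite [X in _ + X]big_nat_rev /= -big_split /= mulr_suml.
  apply: eq_big_nat => i /andP[i_gt0 lt_i]; rewrite add1n subSS natrB 1?ltnW //.
  have i0 : i%:R != 0 :> F by rewrite pnatr_eq0 -lt0n.
  have Ni0 : n.-1%:R - i%:R != 0 :> F by rewrite subr_eq0 eqr_nat gtn_eqF.
  by field; rewrite N0 Ni0 i0.
have q1 : (n - (src d).+1).+1%:R^-1 = 1 :> F by rewrite e0 invr1.
suff : \sum_(s in rotations K) weight d s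
    <= (n - (src d).+1).+1%:R^-1 * b 1%N * #|rotations K|%:R by rewrite q1 mul1r b1.
apply: (weight_bound b_ge0).
  by move=> t /andP[_ lt_t]; rewrite q1 mul1r addrA -big_ltn.
by rewrite /b big_geq // add0r.
Qed.

Lemma sum_weights : (1 < n)%N ->
  \sum_d \sum_(s in rotations K) weight d s
    <= (2 * (\sum_(1 <= i < n.-1) i%:R^-1) + 1 + 2 * (\sum_(1 <= i < n) i%:R^-1))
       * #|rotations K|%:R.
Proof.
move=> n_gt1; have N0 : n.-1%:R != 0 :> F by rewrite pnatr_eq0; lia.
(* [j] counts the vertices after the tail of the dart; the n - 1 darts at each vertex cancel the
   factor 1/(n-1). *)
pose cost (j : nat) : F :=
  if j == 0%N then 2 * (\sum_(1 <= i < n.-1) i%:R^-1) + 1 else 2 / j%:R.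
have weight_cost d : \sum_(s in rotations K) weight d s
    <= cost (n - (src d).+1)%N / n.-1%:R * #|rotations K|%:R.
  rewrite /cost; case: eqP => [/weight_bound_last //|/eqP].
  by rewrite -lt0n => /weight_bound_inner.
apply: (@le_trans _ _ (\sum_d cost (n - (src d).+1)%N / n.-1%:R * #|rotations K|%:R)).
  by apply: ler_sum => d _; apply: weight_cost.
rewrite -mulr_suml ler_wpM2r ?ler0n // -mulr_suml.
rewrite (partition_big src xpredT) //= mulr_suml.
rewrite (eq_bigr (fun k : 'I_n => cost (n - k.+1)%N)) => [|k _]; last first.
  rewrite (eq_bigr (fun _ => cost (n - k.+1)%N)) => [|d /eqP <-//].
  rewrite (eq_bigl [in [set d | src d == k]]) => [|d]; last by rewrite !inE.
  by rewrite sumr_const card_darts_at -(mulr_natr (cost _)) mulfK.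
rewrite -(big_mkord xpredT (fun k => cost (n - k.+1)%N)) big_nat_rev /=.
rewrite (eq_big_nat _ _ (F2 := cost)) => [|i /andP[_ lt_in]]; last first.
  by congr cost; lia.
rewrite big_ltn ?(ltnW n_gt1) // lerD2l mulr_sumr.
by apply: ler_sum_nat => i /andP[i_gt0 _]; rewrite /cost gtn_eqF.
Qed.

End CompleteGraph.

(** * Harmonic sums and the final estimate *)

(** The inequality ln (1 + x) <= x at x = -1/j bounds 1/j by ln j - ln (j-1). *)
Lemma harmonic_le_ln (R : realType) (m : nat) : (0 < m)%N ->
  \sum_(1 <= i < m.+1) i%:R^-1 <= 1 + ln m%:R :> R.
Proof.
elim: m => // -[_ _|m IHm _]; first by rewrite big_nat1 invr1 ln1 addr0.
rewrite big_nat_recr //= (le_trans (lerD (IHm isT) (lexx _))) // -addrA lerD2l.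
have m1_pos : 0 < m.+1%:R :> R by rewrite ltr0n.
have m2_pos : 0 < m.+2%:R :> R by rewrite ltr0n.
rewrite -lerBrDl -lerN2 opprB -ln_div ?posrE //.
have -> : m.+1%:R / m.+2%:R = 1 + - m.+2%:R^-1 :> R.
  by rewrite -[m.+2%:R]natr1 -[X in X / _](addrK 1) mulrBl divff ?div1r // natr1 gt_eqF.
by apply: le_ln1Dx; rewrite ltrN2 invf_lt1 // ltr1n.
Qed.

Theorem proposition1p9 (R : realType) (n : nat) (hn : (1 <= n <= 40748)%N) :
  expected_faces (complete_graph n) R <= 5 * ln (n%:R : R) + 5.
Proof.
case/andP: hn; rewrite leq_eqVlt => /orP[/eqP <- _|n_gt1 _].
  rewrite ln1 mulr0 add0r /expected_faces /num_faces card_ord eqxx sumr_const.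
  (* Division by 0 gives 0, which settles the case of an empty set here and below. *)
  have [->|rot0] := eqVneq #|rotation_systems (complete_graph 1)| 0%N.
    by rewrite mulr0n mul0r.
  by rewrite divff ?pnatr_eq0 // ler1n.
have ln_ge0 : 0 <= ln n%:R :> R by rewrite ln_ge0 // ler1n ltnW.
set bound := 2 * (\sum_(1 <= i < n.-1) i%:R^-1) + 1 + 2 * (\sum_(1 <= i < n) i%:R^-1) : R.
have bound_le : bound <= 5 * ln n%:R + 5.
  have hl : \sum_(1 <= i < n) i%:R^-1 <= 1 + ln n%:R :> R.
    rewrite -(ltn_predK n_gt1) (le_trans (harmonic_le_ln _ _)) ?lerD2l; try lia.
    by rewrite ler_ln ?posrE ?ltr0n ?ler_nat; lia.
  have hl' : \sum_(1 <= i < n.-1) i%:R^-1 <= \sum_(1 <= i < n) i%:R^-1 :> R.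
    rewrite [leRHS](@big_cat_nat _ _ _ n.-1) //=; try lia.
    by rewrite lerDl sumr_ge0 // => i _; rewrite invr_ge0.
  (* Both harmonic sums are at most 1 + ln n, so [bound] is at most 4 ln n + 5, and ln n >= 0. *)
  rewrite /bound; lra.
have sumE : \sum_(rho in rotation_systems (complete_graph n)) (num_faces rho)%:R
    = \sum_d \sum_(s in rotations (complete_graph n)) weight R d s :> R.
  rewrite exchange_big /= -sum_rotation_systems; apply: eq_bigr => rho _.
  by rewrite sum_top_weight /num_faces card_ord gtn_eqF.
have cardE : #|rotation_systems (complete_graph n)|%:R
    = #|rotations (complete_graph n)|%:R :> R.
  by rewrite -!sumr_const (sum_rotation_systems (fun=> 1)).
rewrite /expected_faces sumE cardE.
have [->|rot0] := eqVneq #|rotations (complete_graph n)| 0%N.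
  by rewrite invr0 mulr0 addr_ge0 ?mulr_ge0.
rewrite ler_pdivrMr ?ltr0n ?lt0n // (le_trans (sum_weights _ n_gt1)) //.
by rewrite ler_wpM2r.
Qed.
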